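(* Let $\mathcal{H}$ be a complex Hilbert space of finite dimension $d$, let $\Lambda$ be a quantum channel mapping states on $\mathcal{H}$ to states on $\mathcal{H}$, and let $\mathcal{E}$ be any fixed measure of entanglement on $\mathcal{S}(\mathcal{H}\otimes\mathcal{H})$. If $\Lambda$ is covariant, then the saved entanglement of the local channel $\boldsymbol{\Lambda}=\Lambda\otimes\Lambda$ is zero, i.e. $$\mathrm{SE}=\max_{\boldsymbol{\rho}\in\mathcal{S}(\mathcal{H}\otimes\mathcal{H})}\left[\max_{U\in\mathcal{U}(\mathcal{H})}\mathcal{E}\left(\boldsymbol{\Lambda}\left((I_d\otimes U)\,\boldsymbol{\rho}\,(I_d\otimes U)^\dagger\right)\right)-\mathcal{E}\left(\boldsymbol{\Lambda}(\boldsymbol{\rho})\right)\right]=0 .$$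
   Context: $\mathcal{S}(\mathcal{K})$ denotes the set of density operators (positive semidefinite, trace one) on a finite-dimensional Hilbert space $\mathcal{K}$; $\mathcal{U}(\mathcal{H})$ denotes the set of unitary operators on $\mathcal{H}$; $I_d$ is the identity operator on $\mathcal{H}$. A quantum channel is a completely positive trace-preserving linear map. Covariant channel: a quantum channel $\Lambda$ from operators on $\mathcal{H}$ to operators on $\mathcal{H}$ is covariant if $\Lambda(U\rho U^\dagger)=U\Lambda(\rho)U^\dagger$ for all $\rho\in\mathcal{S}(\mathcal{H})$ and all $U\in\mathcal{U}(\mathcal{H})$. Measure of entanglement: a function $\mathcal{E}:\mathcal{S}(\mathcal{H}\otimes\mathcal{H})\to[0,\infty)$ which is unchanged under local unitary operations, i.e. $\mathcal{E}\left((V\otimes W)\boldsymbol{\rho}(V\otimes W)^\dagger\right)=\mathcal{E}(\boldsymbol{\rho})$ for all $\boldsymbol{\rho}\in\mathcal{S}(\mathcal{H}\otimes\mathcal{H})$ and $V,W\in\mathcal{U}(\mathcal{H})$. Saved entanglement: the quantity $\mathrm{SE}$ displayed in the claim is, by definition, the saved entanglement of the local channel $\boldsymbol{\Lambda}=\Lambda\otimes\Lambda$ with respect to $\mathcal{E}$ (the maximum entanglement that can be saved from $\boldsymbol{\Lambda}$ using unitaries $I_d\otimes U$ applied on one party before the noise acts). *)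

(* Defs.v *)
From mathcomp Require Import all_boot all_order all_algebra.
From mathcomp Require Import spectral sesquilinear.
From mathcomp Require Import complex mxtens.
From mathcomp Require Import classical_sets reals.
Set Implicit Arguments.
Unset Strict Implicit.
Unset Printing Implicit Defensive.
Import Order.TTheory GRing.Theory Num.Theory.
Local Open Scope classical_set_scope.
Local Open Scope ring_scope.
Local Open Scope complex_scope.
Local Open Scope sesquilinear_scope.

(* The Hilbert space of dimension d is C^d with C = R[i], its
   operators are the matrices 'M[R[i]]_d, and the tensor product of two
   operators is the Kronecker product A *t B. *)

(* In R[i], 0 <= z means that z is real and nonnegative, so the condition below
   forces A to be Hermitian. *)
Definition psd (R : realType) n (A : 'M[R[i]]_n) : Prop :=
  forall x : 'cV[R[i]]_n, 0 <= (x^t* *m A *m x) 0 0.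

Definition density (R : realType) n : set 'M[R[i]]_n :=
  [set rho | psd rho /\ \tr rho = 1].
Arguments density R n : clear implicits.

Definition unitaries (R : realType) n : set 'M[R[i]]_n :=
  [set U | U \is unitarymx].
Arguments unitaries R n : clear implicits.

Definition unitary_conj (R : realType) n (U A : 'M[R[i]]_n) : 'M[R[i]]_n :=
  U *m A *m U^t*.

(* For linear f and g, the linear map f (x) g, obtained by expanding X in the
   basis E_ij *t E_kl; it is characterised by tens_map_tens. *)
Definition tens_map (R : realType) m n p q
    (f : 'M[R[i]]_m -> 'M[R[i]]_p) (g : 'M[R[i]]_n -> 'M[R[i]]_q)
    (X : 'M[R[i]]_(m * n)) : 'M[R[i]]_(p * q) :=
  \sum_(i < m) \sum_(j < m) \sum_(k < n) \sum_(l < n)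
    X (mxtens_index (i, k)) (mxtens_index (j, l))
      *: (f (delta_mx i j) *t g (delta_mx k l)).

Lemma tens_map_tens (R : realType) m n p q
    (f : {linear 'M[R[i]]_m -> 'M[R[i]]_p})
    (g : {linear 'M[R[i]]_n -> 'M[R[i]]_q})
    (A : 'M[R[i]]_m) (B : 'M[R[i]]_n) :
  tens_map f g (A *t B) = f A *t g B.
Proof.
have sumE r t (h : {linear 'M[R[i]]_r -> 'M[R[i]]_t}) (M : 'M[R[i]]_r) a b :
    h M a b = \sum_(i < r) \sum_(j < r) M i j * h (delta_mx i j) a b.
  rewrite {1}(matrix_sum_delta M) linear_sum summxE; apply: eq_bigr => i _.
  rewrite linear_sum summxE; apply: eq_bigr => j _.
  by rewrite linearZ mxE.
apply/matrixP=> a b.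
case: (mxtens_indexP a) => a1 a2; case: (mxtens_indexP b) => b1 b2.
rewrite tensmxE !sumE /tens_map summxE mulr_suml; apply: eq_bigr => i _.
rewrite summxE mulr_suml; apply: eq_bigr => j _.
rewrite summxE mulr_sumr; apply: eq_bigr => k _.
rewrite summxE mulr_sumr; apply: eq_bigr => l _.
by rewrite mxE !tensmxE mulrACA.
Qed.

Definition completely_positive (R : realType) m n
    (L : 'M[R[i]]_m -> 'M[R[i]]_n) : Prop :=
  forall (k : nat) (X : 'M[R[i]]_(k * m)),
    psd X -> psd (tens_map (fun Y : 'M[R[i]]_k => Y) L X).

Definition trace_preserving (R : realType) m n
    (L : 'M[R[i]]_m -> 'M[R[i]]_n) : Prop :=
  forall X : 'M[R[i]]_m, \tr (L X) = \tr X.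

Definition quantum_channel (R : realType) m n
    (L : {linear 'M[R[i]]_m -> 'M[R[i]]_n}) : Prop :=
  completely_positive L /\ trace_preserving L.

Definition covariant (R : realType) d (L : 'M[R[i]]_d -> 'M[R[i]]_d) : Prop :=
  forall rho U, density R d rho -> unitaries R d U ->
    L (unitary_conj U rho) = unitary_conj U (L rho).

(* A function on S(H (x) H) is represented by a function on all matrices of
   which only the values on density operators are constrained. *)
Definition entanglement_measure (R : realType) d
    (E : 'M[R[i]]_(d * d) -> R) : Prop :=
  (forall rho, density R (d * d) rho -> 0 <= E rho) /\
  (forall rho V W, density R (d * d) rho ->
     unitaries R d V -> unitaries R d W -> E (unitary_conj (V *t W) rho) = E rho).

Definition is_max (R : realType) (A : set R) (m : R) : Prop :=
  A m /\ ubound A m.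

(* SE = s, including the existence of every maximum involved: mU rho is the
   inner maximum, over U, at the state rho. *)
Definition is_saved_entanglement (R : realType) d
    (E : 'M[R[i]]_(d * d) -> R) (L : 'M[R[i]]_(d * d) -> 'M[R[i]]_(d * d))
    (s : R) : Prop :=
  exists mU : 'M[R[i]]_(d * d) -> R,
    (forall rho, density R (d * d) rho ->
       is_max [set E (L (unitary_conj (1%:M *t U) rho)) | U in unitaries R d]
              (mU rho)) /\
    is_max [set mU rho - E (L rho) | rho in density R (d * d)] s.

(* Main.v *)
Require Import Defs.
From HB Require Import structures.
From mathcomp Require Import all_boot all_order all_algebra.
From mathcomp Require Import spectral sesquilinear.
From mathcomp Require Import complex mxtens.
From mathcomp Require Import classical_sets reals.
Set Implicit Arguments.
Unset Strict Implicit.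
Unset Printing Implicit Defensive.
Import Order.TTheory GRing.Theory Num.Theory.
Local Open Scope ring_scope.
Local Open Scope complex_scope.
Local Open Scope sesquilinear_scope.

(** Covariance extends by linearity from states to all matrices, because the
    rank-one projections span by polarization. Hence the local channel commutes
    with conjugation by a local unitary, and since it maps states to states, the
    invariance of E under local unitaries makes the entanglement left after the
    noise independent of the unitary applied before it. *)

Lemma tens_map_is_linear (R : realType) m n p q
    (f : 'M[R[i]]_m -> 'M[R[i]]_p) (g : 'M[R[i]]_n -> 'M[R[i]]_q) :
  linear (tens_map f g).
Proof.
move=> a X Y; rewrite /tens_map.
do 4 (rewrite scaler_sumr -big_split; apply: eq_bigr => ? _ /=).
by rewrite !mxE scalerA scalerDl.
Qed.

HB.instance Definition _ (R : realType) m n p q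
    (f : 'M[R[i]]_m -> 'M[R[i]]_p) (g : 'M[R[i]]_n -> 'M[R[i]]_q) :=
  GRing.isLinear.Build _ _ _ _ (tens_map f g) (tens_map_is_linear f g).

Lemma unitary_conj_is_linear (R : realType) n (U : 'M[R[i]]_n) :
  linear (unitary_conj U).
Proof.
by move=> a X Y; rewrite /unitary_conj mulmxDr mulmxDl -scalemxAr -scalemxAl.
Qed.

HB.instance Definition _ (R : realType) n (U : 'M[R[i]]_n) :=
  GRing.isLinear.Build _ _ _ _ (unitary_conj U) (unitary_conj_is_linear U).

(** This is the expansion of [X] in products of matrix units. [X] stands on the left so that
    rewriting replaces it by a combination of pure tensors. *)
Lemma tens_map_id (R : realType) m n (X : 'M[R[i]]_(m * n)) :
  X = tens_map idfun idfun X.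
Proof.
apply/matrixP=> a b.
case: (mxtens_indexP a) => a1 a2; case: (mxtens_indexP b) => b1 b2.
rewrite /tens_map summxE (bigD1 a1)//= [X in _ + X]big1 ?addr0; last first.
  move=> i ia; rewrite summxE big1// => j _; rewrite summxE big1// => k _.
  rewrite summxE big1// => l _.
  by rewrite mxE tensmxE !mxE eq_sym (negPf ia) !(mul0r, mulr0).
rewrite summxE (bigD1 b1)//= [X in _ + X]big1 ?addr0; last first.
  move=> j jb; rewrite summxE big1// => k _; rewrite summxE big1// => l _.
  by rewrite mxE tensmxE !mxE [b1 == j]eq_sym (negPf jb) andbF !(mul0r, mulr0).
rewrite summxE (bigD1 a2)//= [X in _ + X]big1 ?addr0; last first.
  move=> k ka; rewrite summxE big1// => l _.
  by rewrite mxE tensmxE !mxE [a2 == k]eq_sym (negPf ka) !mulr0.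
rewrite summxE (bigD1 b2)//= [X in _ + X]big1 ?addr0; last first.
  move=> l lb.
  by rewrite mxE tensmxE !mxE [b2 == l]eq_sym (negPf lb) andbF !mulr0.
by rewrite mxE tensmxE !mxE !eqxx !mulr1.
Qed.

(** Pure tensors span, so a linear identity involving [tens_map] need only be checked on them. *)
Lemma tensmx_ext (R : realType) m n (V : lmodType R[i])
    (F G : {linear 'M[R[i]]_(m * n) -> V}) :
  (forall A B, F (A *t B) = G (A *t B)) -> F =1 G.
Proof.
move=> FG X; rewrite (tens_map_id X) /tens_map.
do 4 (rewrite !linear_sum; apply: eq_bigr => ? _).
by rewrite !linearZ FG.
Qed.

Lemma adjmxM (R : realType) m n p (A : 'M[R[i]]_(m, n)) (B : 'M[R[i]]_(n, p)) :
  (A *m B)^t* = B^t* *m A^t*.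
Proof. by rewrite trmx_mul map_mxM. Qed.

Lemma adjmxD (R : realType) m n (A B : 'M[R[i]]_(m, n)) :
  (A + B)^t* = A^t* + B^t*.
Proof. by rewrite linearD map_mxD. Qed.

Lemma adjmxZ (R : realType) m n a (A : 'M[R[i]]_(m, n)) :
  (a *: A)^t* = Num.conj a *: A^t*.
Proof. by rewrite linearZ map_mxZ. Qed.

Lemma psd_congr (R : realType) m n (M : 'M[R[i]]_(m, n)) (A : 'M[R[i]]_n) :
  psd A -> psd (M *m A *m M^t*).
Proof.
move=> pA x; have := pA (M^t* *m x).
by rewrite adjmxM trmxCK !mulmxA.
Qed.

(** Selecting rows and columns along [s] is a congruence by the matrix whose rows are the rows of
    the identity picked by [s]. *)
Lemma psd_mxsub (R : realType) m n (s : 'I_m -> 'I_n) (A : 'M[R[i]]_n) :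
  psd A -> psd (mxsub s s A).
Proof.
move=> /(@psd_congr _ _ _ (rowsub s 1%:M)); congr psd.
rewrite mul_rowsub_mx mul1mx; apply/matrixP=> a b.
rewrite !mxE (bigD1 (s b))//= big1 ?addr0.
  by rewrite !mxE eqxx rmorph1 mulr1.
by move=> k kb; rewrite !mxE eq_sym (negPf kb) rmorph0 mulr0.
Qed.

(** The map goes from the indices of the flipped product to those of the original one, the direction
    in which [mxsub] reads entries. *)
Definition tens_swap m n (a : 'I_(n * m)) : 'I_(m * n) :=
  mxtens_index ((mxtens_unindex a).2, (mxtens_unindex a).1).
Arguments tens_swap : clear implicits.

Lemma mxsub_tens_swap (R : realType) m n (A : 'M[R[i]]_m) (B : 'M[R[i]]_n) :
  mxsub (tens_swap m n) (tens_swap m n) (A *t B) = B *t A.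
Proof.
apply/matrixP=> a b.
case: (mxtens_indexP a) => a1 a2; case: (mxtens_indexP b) => b1 b2.
by rewrite mxE /tens_swap !mxtens_indexK !tensmxE mulrC.
Qed.

(* f (x) g factors as (id (x) g) o (f (x) id), and f (x) id is id (x) f
   conjugated by the flip of the two factors. *)
Lemma psd_tens_map (R : realType) m n p q
    (f : {linear 'M[R[i]]_m -> 'M[R[i]]_p})
    (g : {linear 'M[R[i]]_n -> 'M[R[i]]_q}) (X : 'M[R[i]]_(m * n)) :
  completely_positive f -> completely_positive g ->
  psd X -> psd (tens_map f g X).
Proof.
move=> fcp gcp pX.
(* Complete positivity has the identity on the left factor: [Y] moves the factor on which [f] acts
   to the right, and [Z] moves it back afterwards. *)
pose Y := mxsub (tens_swap m n) (tens_swap m n) X.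
pose Z := mxsub (tens_swap n p) (tens_swap n p) (tens_map idfun f Y).
have -> : tens_map f g X = tens_map idfun g Z.
  pose F := tens_map idfun g \o mxsub (tens_swap n p) (tens_swap n p) \o
    tens_map idfun f \o mxsub (tens_swap m n) (tens_swap m n).
  apply: (@tensmx_ext _ _ _ _ (tens_map f g) F) => A B.
  by rewrite /F /= mxsub_tens_swap !tens_map_tens mxsub_tens_swap tens_map_tens.
by apply/gcp/psd_mxsub/fcp/psd_mxsub.
Qed.

Lemma mxtrace_tens (R : realType) m n (A : 'M[R[i]]_m) (B : 'M[R[i]]_n) :
  \tr (A *t B) = \tr A * \tr B.
Proof.
rewrite /mxtrace mulr_suml.
under [RHS]eq_bigr do rewrite mulr_sumr.
rewrite pair_bigA/= (reindex (@mxtens_index m n))/=.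
  by apply: eq_bigr => -[i j] _; rewrite tensmxE.
by exists (@mxtens_unindex m n) => ? _; rewrite ?mxtens_indexK ?mxtens_unindexK.
Qed.

Lemma tens_map_trace (R : realType) m n p q
    (f : {linear 'M[R[i]]_m -> 'M[R[i]]_p})
    (g : {linear 'M[R[i]]_n -> 'M[R[i]]_q}) :
  trace_preserving f -> trace_preserving g ->
  trace_preserving (tens_map f g).
Proof.
move=> ftp gtp X.
(* The scalars are viewed as a module over themselves so that [tensmx_ext] applies to the trace. *)
pose F : {linear 'M[R[i]]_(m * n) -> R[i]^o} := mxtrace \o tens_map f g.
apply: (@tensmx_ext _ _ _ _ F mxtrace) => A B.
by rewrite /F /= tens_map_tens !mxtrace_tens ftp gtp.
Qed.

Lemma density_tens_map (R : realType) m n p q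
    (f : {linear 'M[R[i]]_m -> 'M[R[i]]_p})
    (g : {linear 'M[R[i]]_n -> 'M[R[i]]_q}) (X : 'M[R[i]]_(m * n)) :
  quantum_channel f -> quantum_channel g ->
  density R (m * n) X -> density R (p * q) (tens_map f g X).
Proof.
move=> [fcp ftp] [gcp gtp] [pX tX]; split; first exact: psd_tens_map.
by rewrite (tens_map_trace ftp gtp).
Qed.

Lemma adj_col_mul_ge0 (R : realType) n (v : 'cV[R[i]]_n) :
  0 <= (v^t* *m v) 0 0.
Proof.
rewrite mxE sumr_ge0// => k _; rewrite !mxE mulrC.
by rewrite -normCK exprn_ge0.
Qed.

Lemma psd_rank1 (R : realType) n (v : 'cV[R[i]]_n) : psd (v *m v^t*).
Proof.
(* The matrix is the congruence by [v] of the identity of size one. *)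
rewrite -[v in v *m _]mulmx1; apply: psd_congr => x.
by rewrite mulmx1 adj_col_mul_ge0.
Qed.

(** The trace is the sum of the squared moduli of the entries of [v]. *)
Lemma trace_rank1_eq0 (R : realType) n (v : 'cV[R[i]]_n) :
  \tr (v *m v^t*) = 0 -> v = 0.
Proof.
move=> /eqP; rewrite /mxtrace psumr_eq0 => [/allP v0|k _].
  apply/matrixP=> k j; rewrite ord1 [RHS]mxE.
  have := v0 k (mem_index_enum _); rewrite /= mxE big_ord1 !mxE.
  by rewrite -normCK expf_eq0/= normr_eq0 => /eqP.
by rewrite mxE big_ord1 !mxE -normCK exprn_ge0.
Qed.

Lemma density_rank1 (R : realType) n (v : 'cV[R[i]]_n) :
  v != 0 -> density R n ((\tr (v *m v^t*))^-1 *: (v *m v^t*)).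
Proof.
move=> v0; have tv0 : \tr (v *m v^t*) != 0.
  by apply: contra v0 => /eqP /trace_rank1_eq0 ->.
split; last by rewrite mxtraceZ mulVf.
move=> x; rewrite -scalemxAr -scalemxAl mxE mulr_ge0 ?psd_rank1//.
by rewrite invr_ge0 mxtrace_mulC /mxtrace big_ord1 adj_col_mul_ge0.
Qed.

(** Polarization: the values of [F] at [x + y] and at [x + 'i *: y] control the sum and the
    difference of the two cross terms, and every matrix unit is a cross term. *)
Lemma rank1_ext (R : realType) n (V : lmodType R[i])
    (F : {linear 'M[R[i]]_n -> V}) :
  (forall v : 'cV_n, F (v *m v^t*) = 0) -> forall A, F A = 0.
Proof.
move=> F0.
have Fxy (x y : 'cV[R[i]]_n) : F (x *m y^t*) = 0.
  have Fsum : F (x *m y^t*) + F (y *m x^t*) = 0.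
    have := F0 (x + y); rewrite adjmxD mulmxDl !mulmxDr !linearD /= !F0.
    by rewrite add0r addr0.
  (* Since the conjugate of ['i] is [- 'i], the cross terms now carry opposite signs, with a common
     factor ['i] to cancel. *)
  have Fdiff : F (y *m x^t*) - F (x *m y^t*) = 0.
    have := F0 (x + 'i%R *: y).
    rewrite adjmxD mulmxDl !mulmxDr !linearD /= !F0 adjmxZ.
    rewrite -!scalemxAr -!scalemxAl !linearZ /= add0r addr0.
    rewrite conjCi scaleNr addrC -scalerBr => /eqP.
    by rewrite scaler_eq0 (negPf (@neq0Ci _)) => /eqP.
  have : 2 *: F (x *m y^t*) = 0.
    rewrite scaler_nat mulr2n -[RHS]subr0 -{1}Fsum -Fdiff.
    by rewrite opprB addrACA subrr addr0.
  by move/eqP; rewrite scaler_eq0 pnatr_eq0 => /eqP.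
move=> A; rewrite (matrix_sum_delta A) linear_sum big1// => i _.
rewrite linear_sum big1// => j _; rewrite linearZ /=.
have -> : delta_mx i j = delta_mx i 0 *m (delta_mx j 0 : 'cV[R[i]]_n)^t*.
  by rewrite trmx_delta map_delta_mx mul_delta_mx.
by rewrite Fxy scaler0.
Qed.

(** The difference of the two sides is linear in [A], so it suffices that it vanishes on rank-one
    matrices, which are multiples of states. *)
Lemma covariant_unitary_conj (R : realType) d
    (L : {linear 'M[R[i]]_d -> 'M[R[i]]_d}) U A :
  covariant L -> unitaries R d U ->
  L (unitary_conj U A) = unitary_conj U (L A).
Proof.
move=> Lcov uU; apply/eqP; rewrite -subr_eq0; apply/eqP.
pose F : {linear 'M[R[i]]_d -> 'M[R[i]]_d} :=
  (L \o unitary_conj U) \- (unitary_conj U \o L).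
apply: (@rank1_ext _ _ _ F) => v.
rewrite /F /=; apply/eqP; rewrite subr_eq0; apply/eqP.
(* The zero vector cannot be normalised to a state and is treated apart. *)
have [->|v0] := eqVneq v 0; first by rewrite mul0mx !linear0.
have := Lcov _ _ (density_rank1 v0) uU; rewrite !linearZ /=.
apply: scalerI; rewrite invr_eq0.
by apply: contra v0 => /eqP /trace_rank1_eq0 ->.
Qed.

(** On a pure tensor, conjugation by [V *t W] acts on each factor separately, where the covariance
    of [L] applies. *)
Lemma tens_map_conj (R : realType) d (L : {linear 'M[R[i]]_d -> 'M[R[i]]_d})
    V W X :
  covariant L -> unitaries R d V -> unitaries R d W ->
  tens_map L L (unitary_conj (V *t W) X) =
  unitary_conj (V *t W) (tens_map L L X).
Proof.
move=> Lcov uV uW.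
have conj_tens A B : unitary_conj (V *t W) (A *t B) =
    unitary_conj V A *t unitary_conj W B.
  rewrite /unitary_conj; have -> : (V *t W)^t* = V^t* *t W^t*.
    by rewrite trmx_tens map_mxT.
  by rewrite !tensmx_mul.
apply: (@tensmx_ext _ _ _ _ (tens_map L L \o unitary_conj (V *t W))
  (unitary_conj (V *t W) \o tens_map L L)) => A B /=.
by rewrite conj_tens !tens_map_tens conj_tens !covariant_unitary_conj.
Qed.

Lemma density_nonempty (R : realType) n :
  (0 < n)%N -> exists rho, density R n rho.
Proof.
case: n => // n _.
(* Any nonzero vector yields a state; the all-ones vector is a convenient choice. *)
have v0 : (const_mx 1 : 'cV[R[i]]_n.+1) != 0.
  by apply/eqP => /matrixP /(_ 0 0) /eqP; rewrite !mxE oner_eq0.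
by eexists; apply: density_rank1 v0.
Qed.

Theorem theorem1 (R : realType) (d : nat) (hd : (0 < d)%N)
  (L : {linear 'M[R[i]]_d -> 'M[R[i]]_d})
  (hL : quantum_channel L)
  (E : 'M[R[i]]_(d * d) -> R)
  (hE : entanglement_measure E)
  (hcov : covariant L) :
  is_saved_entanglement E (tens_map L L) 0.
Proof.
have u1 : unitaries R d 1%:M by apply/unitarymxP; rewrite mul1mx trmx1 map_mx1.
have EU rho U : density R (d * d) rho -> unitaries R d U ->
    E (tens_map L L (unitary_conj (1%:M *t U) rho)) = E (tens_map L L rho).
  move=> drho uU; rewrite tens_map_conj// hE.2//.
  exact: density_tens_map.
(* By [EU] the quantity maximised over [U] is constant, so its maximum is the value at the
   identity. *)
exists (fun rho => E (tens_map L L rho)); split=> [rho drho|].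
  split; first by exists 1%:M; rewrite ?EU.
  by move=> _ [U uU <-]; rewrite EU.
split; last by move=> _ [rho _ <-]; rewrite subrr.
(* Every difference is zero, but attaining the maximum requires that some state exists, hence
   positive dimension. *)
have [|rho drho] := @density_nonempty R (d * d); first by rewrite muln_gt0 hd.
by exists rho; rewrite ?subrr.
Qed.
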